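(* Let $k\ge 2$ and let $G$ be a $k$-connected equimatchable factor-critical graph with a vertex cut $S$ of size $k$ such that $G-S$ has a component consisting of a single vertex and a component $C$ with at least $k$ vertices. Then $G-S$ has exactly two components, and there is a matching $M$ all of whose edges join a vertex of $S$ to a vertex of $C$, which covers all vertices of $S$, and such that the subgraph of $G$ induced by $V(C)\setminus V(M)$ is connected and randomly matchable.
   Context: All graphs are finite, simple and undirected; subgraphs are induced. A graph is equimatchable if every maximal matching is a maximum matching. A graph is factor-critical if $G-v$ has a perfect matching for every vertex $v$. A graph is randomly matchable if it is equimatchable and has a perfect matching (the connected randomly matchable graphs are exactly $K_{2n}$ and $K_{n,n}$). $V(M)$ denotes the set of vertices covered by the matching $M$. *)

(* Defs.v *)
From mathcomp Require Export all_boot.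

Set Implicit Arguments.
Unset Strict Implicit.
Unset Printing Implicit Defensive.

(** A finite simple graph is a symmetric irreflexive [e : rel T] on a
    [T : finType].  Every notion below takes a vertex set [U] and is about the
    subgraph induced by [U]; the whole graph is the case [U = [set: T]]. *)

Definition induced (T : finType) (e : rel T) (U : {set T}) : rel T :=
  [rel x y | [&& x \in U, y \in U & e x y]].

(** The empty graph counts as connected (it is the complete graph K_0). *)
Definition connected (T : finType) (e : rel T) (U : {set T}) : Prop :=
  {in U &, forall x y, connect (induced e U) x y}.

Definition components (T : finType) (e : rel T) (U : {set T}) : {set {set T}} :=
  equivalence_partition (connect (induced e U)) U.

Definition vertex_cut (T : finType) (e : rel T) (S : {set T}) : Prop :=
  ~ connected e (~: S).

Definition k_connected (T : finType) (e : rel T) (k : nat) : Prop :=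
  k < #|T| /\ forall X : {set T}, #|X| < k -> connected e (~: X).

Definition edges (T : finType) (e : rel T) (U : {set T}) : {set {set T}} :=
  [set [set x; y] | x in U, y in U & e x y].

(** A matching is a set of pairwise disjoint edges, so [V(M)] is [cover M]. *)
Definition matching (T : finType) (e : rel T) (U : {set T})
    (M : {set {set T}}) : bool :=
  (M \subset edges e U) && trivIset M.

Definition maximal_matching (T : finType) (e : rel T) (U : {set T})
    (M : {set {set T}}) : bool :=
  maxset (matching e U) M.

Definition maximum_matching (T : finType) (e : rel T) (U : {set T})
    (M : {set {set T}}) : Prop :=
  matching e U M /\ forall N, matching e U N -> #|N| <= #|M|.

Definition perfect_matching (T : finType) (e : rel T) (U : {set T})
    (M : {set {set T}}) : bool :=
  matching e U M && (cover M == U).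

Definition equimatchable (T : finType) (e : rel T) (U : {set T}) : Prop :=
  forall M, maximal_matching e U M -> maximum_matching e U M.

Definition factor_critical (T : finType) (e : rel T) (U : {set T}) : Prop :=
  forall v, v \in U -> exists M, perfect_matching e (U :\ v) M.

Definition randomly_matchable (T : finType) (e : rel T) (U : {set T}) : Prop :=
  equimatchable e U /\ exists M, perfect_matching e U M.

(* Main.v *)
Require Import Defs.
From mathcomp Require Import all_boot zify.

(** If W is the vertex set of a matching of an equimatchable factor-critical
    graph, then a maximal matching extending it misses at most one vertex, so
    the rest of the graph cannot contain two disjoint odd sets X and Y without
    edges leaving X or Y outside W.  Everything follows from this parity rule.
    By Hall's theorem and k-connectivity there is a matching {s, f s} from S
    into C covering S, which isolates the singleton component v; hence what is
    left of the graph besides v is randomly matchable and splits only into even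
    pieces.  A third component D would be even, but replacing one edge {s, f s}
    by an edge from s to D makes it odd.  If C minus f(S) were a disjoint union
    of nonempty P and Q without edges between them, let A_P be the set of s in S
    with f s adjacent to P.  Rerouting a few matching edges shows that A_P and
    A_Q are disjoint and that the set P together with f(A_P) has no neighbours
    outside A_P and f(R), where R is disjoint from A_P and A_Q and, unless
    empty, consists of one vertex that also plays this role for Q.
    By k-connectivity |A_P| + |R| >= k and |A_Q| + |R| >= k, which contradicts
    |A_P| + |A_Q| + |R| <= k and k >= 2. *)

Set Implicit Arguments.
Unset Strict Implicit.
Unset Printing Implicit Defensive.

(** * Matchings, their covers, and the parity rule *)

Section Matchings.
Variables (T : finType) (e : rel T).
Hypotheses (e_sym : symmetric e) (e_irr : irreflexive e).
Implicit Types (U W X Y : {set T}) (M N : {set {set T}}).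

Definition matchable W : Prop := exists M, perfect_matching e W M.

Definition isolated W X : Prop :=
  [disjoint X & W] /\ forall x y, x \in X -> y \notin W -> e x y -> y \in X.

Lemma edgesP U E :
  reflect (exists x y, [/\ x \in U, y \in U, e x y & E = [set x; y]])
          (E \in edges e U).
Proof.
apply: (iffP imset2P) => [[x y xU] | [x [y [xU yU exy ->]]]].
  by rewrite inE => /andP[yU exy] ->; exists x, y.
by exists x y => //; rewrite inE yU.
Qed.

Lemma matchingS U W M : U \subset W -> matching e U M -> matching e W M.
Proof.
move=> /subsetP UW /andP[/subsetP ME tM]; apply/andP; split=> //.
apply/subsetP=> E /ME /edgesP[x [y [xU yU exy ->]]].
by apply/edgesP; exists x, y; split; auto.
Qed.

Lemma matching_card2 U M E : matching e U M -> E \in M -> #|E| = 2.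
Proof.
case/andP=> /subsetP ME _ /ME /edgesP[x [y [_ _ exy ->]]].
by rewrite cards2; case: eqP exy => // ->; rewrite e_irr.
Qed.

Lemma matching_cover_sub U M : matching e U M -> cover M \subset U.
Proof.
case/andP=> /subsetP ME _; apply/bigcupsP=> E /ME /edgesP[x [y [xU yU _ ->]]].
by apply/subsetP=> z /set2P[] ->.
Qed.

Lemma card_cover_matching U M : matching e U M -> #|cover M| = #|M|.*2.
Proof.
move=> mM; case/andP: (mM) => _ /eqP <-; rewrite -muln2 -sum_nat_const.
by apply: eq_bigr => E /(matching_card2 mM).
Qed.

Lemma matching0 U : matching e U set0.
Proof.
by rewrite /matching sub0set; apply/trivIsetP=> A B; rewrite inE.
Qed.

Lemma matchingU U M N :
  matching e U M -> matching e U N -> [disjoint cover M & cover N] ->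
  matching e U (M :|: N).
Proof.
move=> /andP[sM /trivIsetP tM] /andP[sN /trivIsetP tN] dMN.
rewrite /matching subUset sM sN; apply/trivIsetP=> A B.
have crossMN A' B' : A' \in M -> B' \in N -> [disjoint A' & B'].
  move=> AM BN; apply: disjointWl (bigcup_sup _ AM) _.
  by apply: disjointWr (bigcup_sup _ BN) dMN.
rewrite !inE => /orP[AM|AN] /orP[BM|BN] AB; auto.
by rewrite disjoint_sym; auto.
Qed.

Lemma coverU M N : cover (M :|: N) = cover M :|: cover N.
Proof. exact: bigcup_setU. Qed.

Lemma cover1 (E : {set T}) : cover [set E] = E.
Proof. by rewrite /cover big_set1. Qed.

Lemma perfect_matchingU U W M N :
  perfect_matching e U M -> perfect_matching e W N -> [disjoint U & W] ->
  perfect_matching e (U :|: W) (M :|: N).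
Proof.
move=> /andP[mM /eqP cM] /andP[mN /eqP cN] dUW.
rewrite /perfect_matching coverU cM cN eqxx andbT.
apply: matchingU; rewrite ?cM ?cN //.
  exact: matchingS (subsetUl _ _) mM.
exact: matchingS (subsetUr _ _) mN.
Qed.

Lemma perfect_matching2 x y :
  e x y -> perfect_matching e [set x; y] [set [set x; y]].
Proof.
move=> exy; rewrite /perfect_matching cover1 eqxx andbT; apply/andP; split.
  rewrite sub1set; apply/edgesP; exists x, y.
  by rewrite !inE !eqxx orbT.
by apply/trivIsetP=> A B /set1P-> /set1P->; rewrite eqxx.
Qed.

Lemma matchableU2 W x y :
  e x y -> x \notin W -> y \notin W -> matchable W ->
  matchable (x |: (y |: W)).
Proof.
move=> exy xW yW [M pM]; exists ([set [set x; y]] :|: M).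
rewrite setUA; apply: perfect_matchingU (perfect_matching2 exy) pM _.
by rewrite disjoint_sym disjoints_subset; apply/subsetP=> z zW;
  rewrite !inE; apply/norP; split; apply: contraTneq zW => ->.
Qed.

Lemma perfect_matching_fun (A : {set T}) (f : T -> T) :
  {in A &, injective f} -> {in A, forall x, e x (f x)} ->
  [disjoint A & f @: A] ->
  perfect_matching e (A :|: f @: A) [set [set x; f x] | x in A].
Proof.
move=> f_inj ef dA.
have ndA x y : x \in A -> y \in A -> x != f y.
  move=> xA yA; apply: contraTneq dA => xE; apply/pred0Pn; exists x.
  by rewrite /= xA xE imset_f.
rewrite /perfect_matching; apply/andP; split; last first.
  apply/eqP/setP=> z; apply/bigcupP/setUP => [[E /imsetP[x xA ->]]|].
    by case/set2P=> ->; [left | right; rewrite imset_f].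
  case=> [zA | /imsetP[x xA ->]].
    by exists [set z; f z]; rewrite ?set21 //; apply/imsetP; exists z.
  by exists [set x; f x]; rewrite ?set22 //; apply/imsetP; exists x.
apply/andP; split.
  apply/subsetP=> _ /imsetP[x xA ->]; apply/edgesP; exists x, (f x).
  by rewrite !inE xA imset_f ?orbT ?ef.
apply/trivIsetP=> _ _ /imsetP[x xA ->] /imsetP[y yA ->] xy.
apply/pred0P=> z /=; apply/andP=> -[/set2P zx /set2P zy].
case/eqP: xy; suff -> : x = y by [].
case: zx zy => -> [] // E; last exact: f_inj.
  by move: (ndA _ _ xA yA); rewrite E eqxx.
by move: (ndA _ _ yA xA); rewrite -E eqxx.
Qed.

(** Since [M] covers [W], an edge of [N] meeting [W] already lies in [M], so the edges of [N]
    meeting [X] stay inside [X]. If they covered [X], they would split it into pairs. *)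
Lemma matching_odd_uncovered W X M N :
  perfect_matching e W M -> M \subset N -> matching e [set: T] N ->
  isolated W X -> odd #|X| -> exists2 x, x \in X & x \notin cover N.
Proof.
move=> /andP[_ /eqP cM] /subsetP MN mN [dXW cX] oddX; apply/subsetPn.
case/andP: (mN) => /subsetP NE /trivIsetP tN.
apply: contraL oddX => sX.
pose NX := [set E in N | E \subset X].
have -> : X = cover NX.
  apply/eqP; rewrite eqEsubset; apply/andP; split; last first.
    by apply/bigcupsP=> E; rewrite inE => /andP[].
  apply/subsetP=> x xX; have /bigcupP[E EN xE] := subsetP sX x xX.
  apply/bigcupP; exists E => //; rewrite inE EN /=.
  have dEW z : z \in E -> z \notin W.
    move=> zE; rewrite -cM; apply/negP=> /bigcupP[F FM zF].
    have EF : E = F.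
      apply: contraTeq zF => EF.
      by rewrite (disjointFr (tN _ _ EN (MN _ FM) EF)).
    have : x \in W by rewrite -cM; apply/bigcupP; exists F; rewrite // -EF.
    by rewrite (disjointFr dXW).
  have /edgesP[a [b [_ _ eab EE]]] := NE _ EN.
  move: xE dEW eab; rewrite EE => /set2P[] <- dEW exz; apply/subsetP=> z /set2P[] -> //.
    by apply: (cX x) => //; apply: dEW; rewrite set22.
  by apply: (cX x) => //; rewrite ?(e_sym x) // dEW ?set21.
have mNX : matching e [set: T] NX.
  rewrite /matching; apply/andP; split.
    by apply/subsetP=> E; rewrite inE => /andP[/NE].
  by apply/trivIsetP=> A B; rewrite !inE => /andP[AN _] /andP[BN _]; apply: tN.
by rewrite (card_cover_matching mNX) odd_double.
Qed.

Hypothesis hequi : equimatchable e [set: T].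
Hypothesis hfc : factor_critical e [set: T].

(** A perfect matching of the graph minus [x] misses one vertex only, and the maximum matching [N]
    is at least as large. *)
Lemma maximal_matching_uncovered N x y :
  maximal_matching e [set: T] N -> x \notin cover N -> y \notin cover N ->
  x = y.
Proof.
move=> /hequi[mN maxN] xN yN; apply/eqP; apply: contraT => xy.
have [F /andP[mF /eqP cF]] := hfc (in_setT x).
have mF' := matchingS (subsetT _) mF.
have := maxN _ mF'; rewrite -leq_double -(card_cover_matching mF)
  -(card_cover_matching mN).
have /subset_leq_card : cover N \subset [set: T] :\ x :\ y.
  by apply/subsetP=> z zN; rewrite !inE andbT;
     apply/andP; split; apply: contraTneq zN => ->.
rewrite cF => le1 le2; have := leq_trans le2 le1.
by rewrite [X in X <= _ -> _](cardsD1 y) !inE eq_sym xy ltnn.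
Qed.

Lemma no_two_odd W X Y :
  matchable W -> isolated W X -> isolated W Y -> [disjoint X & Y] ->
  odd #|X| -> odd #|Y| -> False.
Proof.
move=> [M pM] iX iY dXY oX oY.
have mM : matching e [set: T] M.
  by case/andP: pM => mM _; apply: matchingS mM.
have [N maxN MN] := maxset_exists mM.
have mN := maxsetp maxN.
have [x xX xN] := matching_odd_uncovered pM MN mN iX oX.
have [y yY yN] := matching_odd_uncovered pM MN mN iY oY.
have xy := maximal_matching_uncovered maxN xN yN.
by move: yY; rewrite -xy (disjointFr dXY).
Qed.

End Matchings.

(* Halmos-Vaughan induction, splitting off a tight proper subset if there is one. *)
Lemma hall (T : finType) (N : T -> {set T}) (A : {set T}) :
  (forall X : {set T}, X \subset A -> #|X| <= #|\bigcup_(x in X) N x|) ->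
  exists2 f : T -> T, {in A &, injective f} & {in A, forall x, f x \in N x}.
Proof.
move: {2}#|A| (leqnn #|A|) => n.
elim: n N A => [|n IHn] N A.
  rewrite leqn0 cards_eq0 => /eqP-> _; exists id => x; last by rewrite inE.
  by move=> y _ _.
move=> An hallA.
have [A0 | /set0Pn[a aA]] := eqVneq A set0.
  by exists id => x; [move=> y _ _ | rewrite A0 inE].
have [/existsP[B /and4P[BA B0 ABn /eqP cB]] | tight] :=
  boolP [exists B : {set T}, [&& B \subset A, B != set0, B != A
           & #|B| == #|\bigcup_(x in B) N x|]].
  set NB := \bigcup_(x in B) N x in cB.
  have pBA : B \proper A by rewrite properEneq ABn.
  have ltBA := proper_card pBA.
  have [f f_inj fN] : exists2 f : T -> T,
      {in B &, injective f} & {in B, forall x, f x \in N x}.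
    apply: IHn; first by rewrite -ltnS (leq_trans ltBA).
    by move=> X XB; apply: hallA; apply: subset_trans BA.
  (* Hall's condition survives the loss of [NB]: apply it to [X :|: B] and subtract the tight
     equality for [B]. *)
  have [g g_inj gN] : exists2 g : T -> T, {in A :\: B &, injective g}
      & {in A :\: B, forall x, g x \in N x :\: NB}.
    apply: IHn => [|X XAB].
      rewrite -ltnS (leq_trans _ An) // cardsD (setIidPr BA).
      by rewrite ltn_subrL !card_gt0 B0; apply/set0Pn; exists a.
    have dXB : [disjoint X & B].
      by apply: disjointWl XAB _; rewrite -setI_eq0 setDE setIAC -setIA setICr setI0.
    have := hallA (X :|: B); rewrite subUset BA (subset_trans XAB (subsetDl _ _)).
    move=> /(_ isT); rewrite bigcup_setU cardsU (disjoint_setI0 dXB) cards0 subn0.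
    rewrite -/NB cB => le1.
    rewrite -(leq_add2r #|NB|); apply: leq_trans le1 _.
    apply: leq_trans (leq_card_setU _ _); apply: subset_leq_card.
    rewrite subUset subsetUr andbT; apply/subsetP=> z /bigcupP[x xX zx].
    rewrite inE; have [_|zNB] := boolP (z \in NB); first by rewrite orbT.
    by apply/orP; left; apply/bigcupP; exists x => //; rewrite inE zNB.
  exists (fun x => if x \in B then f x else g x) => [x y xA yA | x xA].
    case: ifPn => xB; case: ifPn => yB; first exact: f_inj.
    - have : g y \in N y :\: NB by apply: gN; rewrite inE yB.
      rewrite inE => /andP[gyNB _] E; case/negP: gyNB; rewrite -E.
      by apply/bigcupP; exists x => //; apply: fN.
    - have : g x \in N x :\: NB by apply: gN; rewrite inE xB.
      rewrite inE => /andP[gxNB _] E; case/negP: gxNB; rewrite E.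
      by apply/bigcupP; exists y => //; apply: fN.
    by apply: g_inj; rewrite inE ?xB ?yB.
  case: ifPn => xB; first exact: fN.
  by have := gN x; rewrite !inE xB xA => /(_ isT)/andP[].
(* Now every nonempty proper subset has a spare neighbour, so [a] may be assigned an arbitrary
   [b]. *)
have /card_gt0P[b bNa] : 0 < #|N a|.
  by have := hallA [set a]; rewrite sub1set big_set1 cards1; apply.
have [f f_inj fN] : exists2 f : T -> T, {in A :\ a &, injective f}
    & {in A :\ a, forall x, f x \in N x :\ b}.
  apply: IHn => [|X XA].
    by rewrite -ltnS (leq_trans _ An) // (cardsD1 a A) aA.
  have [-> | X0] := eqVneq X set0; first by rewrite cards0.
  have XA' := subset_trans XA (subsetDl _ _).
  have XnA : X != A.
    by apply: contraTneq aA => <-; apply/negP=> /(subsetP XA); rewrite !inE eqxx.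
  have := hallA X XA'; rewrite leq_eqVlt.
  have /negbTE-> : #|X| != #|\bigcup_(x in X) N x|.
    by apply: contra tight => cX; apply/existsP; exists X; rewrite XA' X0 XnA.
  move=> /= lt; rewrite -ltnS (leq_trans lt) //.
  rewrite -add1n -(cards1 b); apply: leq_trans (leq_card_setU _ _).
  apply: subset_leq_card; apply/subsetP=> z /bigcupP[x xX zx].
  rewrite inE; have [_|zb] := boolP (z \in [set b]); first by [].
  by apply/bigcupP; exists x => //; rewrite inE zx andbT.
exists (fun x => if x == a then b else f x) => [x y xA yA | x xA].
  have [->|xa] := eqVneq x a; have [->|ya] := eqVneq y a => //.
  - by have := fN y; rewrite !inE ya yA => /(_ isT)/andP[/eqP fb _] E; case: fb.
  - by have := fN x; rewrite !inE xa xA => /(_ isT)/andP[/eqP fb _] E; case: fb.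
  by apply: f_inj; rewrite !inE ?xa ?ya.
have [->|xa] := eqVneq x a => //.
by have := fN x; rewrite !inE xa xA => /(_ isT)/andP[].
Qed.

(** * The matching of [S] into [C] and the sets it isolates *)

Section Swapping.
Variables (T : finType) (e : rel T).
Hypotheses (e_sym : symmetric e) (e_irr : irreflexive e).
Hypothesis hequi : equimatchable e [set: T].
Hypothesis hfc : factor_critical e [set: T].
Variables (S C : {set T}) (v : T) (f : T -> T).
Hypotheses (vS : v \notin S) (vC : v \notin C) (dSC : [disjoint S & C]).
Hypothesis evS : forall x, e v x = (x \in S).
Hypothesis C_closed : forall x y, x \in C -> y \notin S -> e x y -> y \in C.
Hypothesis f_inj : {in S &, injective f}.
Hypothesis fC : {in S, forall s, f s \in C}.
Hypothesis ef : {in S, forall s, e s (f s)}.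
Implicit Types (P Q J W X : {set T}).

(* The endpoints of the edges {s, f s} with s in S minus J. *)
Definition matched J : {set T} := locked ((S :\: J) :|: f @: (S :\: J)).

Lemma matchedP J : matched J = (S :\: J) :|: f @: (S :\: J).
Proof. by rewrite /matched -lock. Qed.

Lemma matchable_matched J : matchable e (matched J).
Proof.
rewrite matchedP; exists [set [set x; f x] | x in S :\: J].
apply: perfect_matching_fun.
- by move=> x y /setDP[xS _] /setDP[yS _]; apply: f_inj.
- by move=> x /setDP[xS _]; apply: ef.
apply: disjointWl (subsetDl _ _) _; apply: disjointWr dSC.
by apply/subsetP=> _ /imsetP[x /setDP[xS _] ->]; apply: fC.
Qed.

Lemma mem_matched_S J s : s \in S -> (s \in matched J) = (s \notin J).
Proof.
move=> sS; rewrite matchedP !inE sS andbT; case: (s \in J) => //=.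
apply/imsetP=> -[x /setDP[xS _] sE].
by have := fC xS; rewrite -sE (disjointFr dSC).
Qed.

Lemma mem_matched_fS J s : s \in S -> (f s \in matched J) = (s \notin J).
Proof.
move=> sS; rewrite matchedP !inE (disjointFl dSC (fC sS)) andbF /=.
apply/imsetP/idP => [[x /setDP[xS xJ] /(f_inj sS xS)-> //] | sJ].
by exists s; rewrite ?inE ?sJ.
Qed.

Lemma notin_matched J x : x \notin S -> x \notin f @: S -> x \notin matched J.
Proof.
move=> xS xfS; rewrite matchedP !inE (negbTE xS) andbF /=.
by apply: contra xfS; apply/subsetP/imsetS/subsetDl.
Qed.

Lemma f_neq s t : s \in S -> t \in S -> s != t -> f s != f t.
Proof. by move=> sS tS; apply: contra_neq; apply: f_inj. Qed.

Definition adj x X := [exists y in X, e x y].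

Lemma adjP x X : reflect (exists2 y, y \in X & e x y) (adj x X).
Proof. exact: exists_inP. Qed.

Lemma isolated_v W : S \subset W -> v \notin W -> isolated e W [set v].
Proof.
move=> /subsetP SW vW; split; first by rewrite disjoints1.
by move=> _ y /set1P-> yW; rewrite evS => /SW; rewrite (negbTE yW).
Qed.

(** [[set v]] is the other odd set of the parity rule: all neighbours of [v] lie in [S], hence in
    [W]. *)
Lemma isolating_even W X :
  matchable e W -> S \subset W -> v \notin W -> v \notin X -> isolated e W X ->
  ~~ odd #|X|.
Proof.
move=> mW SW vW vX iX; apply/negP=> oX.
apply: (no_two_odd e_sym e_irr hequi hfc mW iX (isolated_v SW vW)) => //.
  by rewrite disjoint_sym disjoints1.
by rewrite cards1.
Qed.

(** Either side may be empty here; results that need nonempty sides receive a vertex of each. *)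
Definition separation P Q :=
  [/\ P :|: Q = C :\: f @: S, [disjoint P & Q]
    & forall x y, x \in P -> y \in Q -> ~~ e x y].

Lemma separation_sym P Q : separation P Q -> separation Q P.
Proof.
move=> [PQ dPQ ePQ]; split; rewrite 1?setUC 1?disjoint_sym // => x y xQ yP.
by rewrite e_sym; apply: ePQ.
Qed.

(* Vertices of different colors are distinct; [by_color] relies on this to
   check that the new edges of a rerouted matching are pairwise disjoint. *)
Definition color P Q x :=
  if x \in S then 0 else if x \in f @: S then 1 else
  if x \in P then 2 else if x \in Q then 3 else 4.

(** * Parity of one side of a separation *)

Section Separation.
Variables P Q : {set T}.
Hypothesis PQ : separation P Q.
Local Notation col := (color P Q).

Lemma color_S x : x \in S -> col x = 0.
Proof. by rewrite /color => ->. Qed.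

Lemma color_fS x : x \in S -> col (f x) = 1.
Proof. by move=> xS; rewrite /color (disjointFl dSC (fC xS)) imset_f. Qed.

Lemma color_v : col v = 4.
Proof.
case: PQ => /setP/(_ v) + _ _; rewrite !inE (negbTE vC) andbF.
move=> /negbT/norP[vP vQ]; rewrite /color (negbTE vS) (negbTE vP) (negbTE vQ).
by case: ifP => // /imsetP[x xS vE]; move: vC; rewrite vE fC.
Qed.

Lemma color_P x : x \in P -> col x = 2.
Proof.
move=> xP; case: PQ => /setP/(_ x); rewrite !inE xP => /esym/andP[xf xC] _ _.
by rewrite /color (disjointFl dSC xC) (negbTE xf) xP.
Qed.

Lemma color_Q x : x \in Q -> col x = 3.
Proof.
move=> xQ; case: PQ => /setP/(_ x); rewrite !inE xQ orbT.
move=> /esym/andP[xf xC] dPQ _.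
by rewrite /color (disjointFl dSC xC) (negbTE xf) (disjointFl dPQ xQ) xQ.
Qed.

Lemma notin_matched_color J x : 1 < col x -> x \notin matched J.
Proof.
move=> xc; apply: notin_matched; apply: contraL xc; first by move/color_S=> ->.
by case/imsetP=> s /color_fS Es ->; rewrite Es.
Qed.

Lemma P_neighbour x y : x \in P -> e x y ->
  [\/ y \in S, exists2 s, s \in S & y = f s | y \in P].
Proof.
move=> xP exy; case: PQ => PQE _ ePQ.
have [yS | yS] := boolP (y \in S); first by constructor 1.
have [/imsetP ? | yf] := boolP (y \in f @: S); first by constructor 2.
have xC : x \in C by have /setP/(_ x) := PQE; rewrite !inE xP => /esym/andP[].
have /setP/(_ y) := PQE; rewrite !inE yf (C_closed xC yS exy) /=.
by case/orP=> [|/(ePQ _ _ xP)]; [constructor 3 | rewrite exy].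
Qed.

(** [J] indexes the pairs [{s, f s}] that a rerouting breaks up, and [p] is the only covered vertex
    of [P]. Unbroken pairs lie in [W], so only the ends of broken pairs need the last two
    hypotheses. *)
Lemma isolated_P W J p : matched J \subset W -> p \in W ->
  (forall x, x \in P -> x != p -> x \notin W) ->
  (forall s, s \in J -> s \in S -> (s \in W) || ~~ adj s P) ->
  (forall s, s \in J -> s \in S -> (f s \in W) || ~~ adj (f s) P) ->
  isolated e W (P :\ p).
Proof.
move=> /subsetP JW pW PW nS nf; split=> [|x y /setD1P[_ xP] yW exy].
  by rewrite disjoint_subset; apply/subsetP=> x /setD1P[xp xP]; apply: PW.
have adjP : adj y P by apply/adjP; exists x; rewrite 1?e_sym.
have [yS | [s sS ys] | yP] := P_neighbour xP exy.
- have [yJ | yJ] := boolP (y \in J);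
    first by have := nS y yJ yS; rewrite adjP (negbTE yW).
  by case/negP: yW; apply: JW; rewrite mem_matched_S.
- move: yW adjP; rewrite ys => yW adjP.
  have [sJ | sJ] := boolP (s \in J);
    first by have := nf s sJ sS; rewrite adjP (negbTE yW).
  by case/negP: yW; apply: JW; rewrite mem_matched_fS.
by rewrite !inE yP andbT; apply: contraNneq yW => ->.
Qed.

(** The unaltered matching, with no broken pair, already isolates [P]. *)
Lemma even_P : ~~ odd #|P|.
Proof.
apply: (@isolating_even (matched set0)); first exact: matchable_matched.
- by apply/subsetP=> s sS; rewrite mem_matched_S ?inE.
- by apply: notin_matched_color; rewrite color_v.
- by apply/negP=> /color_P; rewrite color_v.
split=> [|x y xP yW exy].
  rewrite disjoint_subset; apply/subsetP=> x /color_P xc.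
  by apply: notin_matched_color; rewrite xc.
have [yS | [s sS ys] | //] := P_neighbour xP exy; move: yW.
  by rewrite mem_matched_S ?inE.
by rewrite ys mem_matched_fS ?inE.
Qed.

Lemma odd_P1 p : p \in P -> odd #|P :\ p|.
Proof. by move=> pP; have := even_P; rewrite (cardsD1 p) pP /= negbK. Qed.

(** The contradiction reached by reroutings that leave [v] uncovered: [P :\ p] is odd because [P] is
    even, and [[set v]] is odd too. *)
Lemma no_isolated_P W J p : matchable e W -> matched J \subset W ->
  v \notin W -> p \in P -> p \in W ->
  (forall x, x \in P -> x != p -> x \notin W) ->
  (forall s, s \in J -> s \in S -> s \in W) ->
  (forall s, s \in J -> s \in S -> (f s \in W) || ~~ adj (f s) P) -> False.
Proof.
move=> mW JW vW pP pW PW nS nf.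
have iP : isolated e W (P :\ p).
  by apply: (isolated_P JW) => // s sJ sS; rewrite nS.
apply/negP: (odd_P1 pP); apply: isolating_even iP => //.
  apply/subsetP=> s sS; have [sJ|sJ] := boolP (s \in J); first exact: nS.
  by apply: (subsetP JW); rewrite mem_matched_S.
by apply/negP=> /setD1P[_ /color_P]; rewrite color_v.
Qed.

End Separation.

(** * Exchange arguments on the matching edges *)

Section Rerouting.
Variables P Q : {set T}.
Hypothesis PQ : separation P Q.
Local Notation col := (color P Q).
Local Notation cS := (@color_S P Q).
Local Notation cfS := (@color_fS P Q).
Local Notation cv := (color_v PQ).
Local Notation cP := (color_P PQ).
Local Notation cQ := (color_Q PQ).

Ltac by_color := first
  [ done | by rewrite eq_sym
  | by apply/eqP=> /(congr1 col); congruence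
  | by apply: f_neq; rewrite // eq_sym
  | by rewrite mem_matched_S ?inE ?eqxx ?orbT
  | by rewrite mem_matched_fS ?inE ?eqxx ?orbT
  | by apply: (@notin_matched_color P Q);
       match goal with H : col ?x = _ |- _ => rewrite H end ].
Ltac outside := rewrite ?inE ?negb_or; repeat (apply/andP; split); by_color.
Ltac inside := by rewrite !inE ?eqxx ?orbT.

(* Replace {s, f s} by {s, p}: then f s must be matchable into P minus p. *)
Lemma swap_S s : s \in S -> adj s P -> adj (f s) P && ~~ adj (f s) Q.
Proof.
move=> sS /adjP[p pP esp].
have cs := cS sS; have cf := cfS sS; have cp := cP pP; have c_v := cv.
apply/andP; split.
  apply: contraT => nP.
  exfalso; apply: (@no_isolated_P P Q PQ (s |: (p |: matched [set s])) [set s] p)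
  => //; try inside; try outside.
  - apply: matchableU2 => //; try outside. exact: matchable_matched.
  - by apply/subsetP=> x xm; rewrite !inE xm ?orbT.
  - by move=> x /cP cx xp; outside.
  - by move=> _ /set1P-> _; inside.
  - by move=> _ /set1P-> _; rewrite nP orbT.
(* With [{s, p}] and [{f s, q}] both ends of the broken pair are covered, so [P :\ p] is isolated
   again. *)
apply/negP=> /adjP[q qQ efq]; have c_q := cQ qQ.
exfalso; apply: (@no_isolated_P P Q PQ (f s |: (q |: (s |: (p |: matched [set s])))) [set s] p)
  => //; try inside; try outside.
- do 2 (apply: matchableU2 => //; try outside); exact: matchable_matched.
- by apply/subsetP=> x xm; rewrite !inE xm ?orbT.
- by move=> x /cP cx xp; outside.
- by move=> _ /set1P-> _; inside.
- by move=> _ /set1P-> _; rewrite !inE eqxx.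
Qed.

(** For reroutings that cover [v]: the two odd sets are then taken from [P] and [Q]. *)
Lemma no_two_odd_parts W p q : p \in P -> q \in Q -> matchable e W ->
  isolated e W (P :\ p) -> isolated e W (Q :\ q) -> False.
Proof.
move=> pP qQ mW iP iQ; apply: (no_two_odd e_sym e_irr hequi hfc mW iP iQ).
- rewrite disjoint_subset; apply/subsetP=> x /setD1P[_ /cP cx].
  by apply/negP=> /setD1P[_ /cQ]; rewrite cx.
- exact: odd_P1 PQ _ pP.
exact: odd_P1 (separation_sym PQ) _ qQ.
Qed.

(* Replace {i, f i} and {j, f j} by {f i, p}, {f j, q} and {v, i}: then j must
   be matchable into one of the two remaining odd sets. *)
Lemma swap_fS i j : i \in S -> j \in S -> i != j -> adj (f i) P -> adj (f j) Q ->
  adj j Q.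
Proof.
move=> iS jS ij /adjP[p pP efip] /adjP[q qQ efjq]; apply: contraT => njQ.
(* If [j] had a neighbour in [P], [swap_S] would forbid the edge from [f j] to [q]. *)
have njP : ~~ adj j P.
  apply/negP=> /(swap_S jS)/andP[_ /adjP[]]; by exists q.
have ci := cS iS; have cj := cS jS; have cfi := cfS iS; have cfj := cfS jS.
have cp := cP pP; have c_q := cQ qQ; have c_v := cv.
set W := f i |: (p |: (f j |: (q |: (v |: (i |: matched [set i; j]))))).
have mW : matchable e W.
  rewrite /W.
  do 2 (apply: matchableU2 => //; try outside).
  apply: matchableU2 => //; try outside; first by rewrite evS.
  exact: matchable_matched.
have JW : matched [set i; j] \subset W.
  by apply/subsetP=> x xm; rewrite !inE xm ?orbT.
have iP : isolated e W (P :\ p).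
  apply: (isolated_P PQ JW); try inside.
  - by move=> x /cP cx xp; outside.
  - by move=> t; rewrite !inE => /orP[]/eqP-> _; rewrite ?njP ?eqxx ?orbT.
  - by move=> t; rewrite !inE => /orP[]/eqP-> _; rewrite ?eqxx ?orbT.
have iQ : isolated e W (Q :\ q).
  apply: (isolated_P (separation_sym PQ) JW); try inside.
  - by move=> x /cQ cx xp; outside.
  - by move=> t; rewrite !inE => /orP[]/eqP-> _; rewrite ?njQ ?eqxx ?orbT.
  - by move=> t; rewrite !inE => /orP[]/eqP-> _; rewrite ?eqxx ?orbT.
case: (no_two_odd_parts pP qQ mW iP iQ).
Qed.

(** Otherwise rematch along [{f i, j}] and [{i, p}]: only [f j] is exposed, and it has no neighbour
    in [P]. *)
Lemma cross_fS_S i j : i \in S -> j \in S -> adj i P -> ~~ adj (f j) P ->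
  ~~ e (f i) j.
Proof.
move=> iS jS iP njP; apply/negP=> efij; case/adjP: (iP) => p pP eip.
have ij : i != j by apply: contraNneq njP => <-; case/andP: (swap_S iS iP).
have ci := cS iS; have cj := cS jS; have cfi := cfS iS; have cfj := cfS jS.
have cp := cP pP; have c_v := cv.
apply: (@no_isolated_P P Q PQ
  (f i |: (j |: (i |: (p |: matched [set i; j])))) [set i; j] p) => //;
  try inside; try outside.
- do 2 (apply: matchableU2 => //; try outside); exact: matchable_matched.
- by apply/subsetP=> x xm; rewrite !inE xm ?orbT.
- by move=> x /cP cx xp; outside.
- by move=> t; rewrite !inE => /orP[]/eqP-> _; rewrite ?eqxx ?orbT.
- by move=> t; rewrite !inE => /orP[]/eqP-> _; rewrite ?njP ?eqxx ?orbT.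
Qed.

(** The edge [{f i, f j}] together with [{i, p}] and [{j, q}] would cover both broken pairs, leaving
    [P :\ p] and [[set v]] odd and isolated. *)
Lemma cross_fS_fS i j : i \in S -> j \in S -> i != j -> adj i P -> adj j Q ->
  ~~ e (f i) (f j).
Proof.
move=> iS jS ij /adjP[p pP eip] /adjP[q qQ ejq]; apply/negP=> eff.
have ci := cS iS; have cj := cS jS; have cfi := cfS iS; have cfj := cfS jS.
have cp := cP pP; have c_q := cQ qQ; have c_v := cv.
apply: (@no_isolated_P P Q PQ
  (f i |: (f j |: (i |: (p |: (j |: (q |: matched [set i; j])))))) [set i; j] p)
  => //; try inside; try outside.
- do 3 (apply: matchableU2 => //; try outside); exact: matchable_matched.
- by apply/subsetP=> x xm; rewrite !inE xm ?orbT.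
- by move=> x /cP cx xp; outside.
- by move=> t; rewrite !inE => /orP[]/eqP-> _; rewrite ?eqxx ?orbT.
- by move=> t; rewrite !inE => /orP[]/eqP-> _; rewrite ?eqxx ?orbT.
Qed.

(** For distinct [r] and [t], use [{f i, f r}], [{f j, f t}], [{i, p}], [{j, q}] and [{v, r}]. The
    only exposed end of a broken pair is [t], which has no neighbour in [P] or [Q], so [P :\ p] and
    [Q :\ q] are odd and isolated. *)
Lemma common_exit i j r t :
  i \in S -> j \in S -> r \in S -> t \in S -> i != j ->
  adj i P -> adj j Q ->
  ~~ adj r P -> ~~ adj r Q -> ~~ adj t P -> ~~ adj t Q ->
  e (f i) (f r) -> e (f j) (f t) -> r = t.
Proof.
move=> iS jS rS tS ij iP jQ nrP nrQ ntP ntQ eir ejt; apply/eqP/contraT => rt.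
have ir : i != r by apply: contraNneq nrP => <-.
have it : i != t by apply: contraNneq ntP => <-.
have jr : j != r by apply: contraNneq nrQ => <-.
have jt : j != t by apply: contraNneq ntQ => <-.
case/adjP: iP => p pP eip; case/adjP: jQ => q qQ ejq.
have ci := cS iS; have cj := cS jS; have cfi := cfS iS; have cfj := cfS jS.
have cr := cS rS; have ct := cS tS; have cfr := cfS rS; have cft := cfS tS.
have cp := cP pP; have c_q := cQ qQ; have c_v := cv.
pose J := i |: (j |: [set r; t]).
pose W := f i |: (f r |: (f j |: (f t |:
  (i |: (p |: (j |: (q |: (v |: (r |: matched J))))))))).
have mW : matchable e W.
  rewrite /W /J.
  do 4 (apply: matchableU2 => //; try outside).
  apply: matchableU2 => //; try outside; first by rewrite evS.
  exact: matchable_matched.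
have JW : matched J \subset W.
  by apply/subsetP=> x xm; rewrite !inE xm ?orbT.
have iP : isolated e W (P :\ p).
  apply: (isolated_P PQ JW); rewrite /W; try inside.
  - by move=> x /cP cx xp; outside.
  - by move=> s; rewrite !inE => /or4P[]/eqP-> _; rewrite ?ntP ?eqxx ?orbT.
  - by move=> s; rewrite !inE => /or4P[]/eqP-> _; rewrite ?eqxx ?orbT.
have iQ : isolated e W (Q :\ q).
  apply: (isolated_P (separation_sym PQ) JW); rewrite /W; try inside.
  - by move=> x /cQ cx xp; outside.
  - by move=> s; rewrite !inE => /or4P[]/eqP-> _; rewrite ?ntQ ?eqxx ?orbT.
  - by move=> s; rewrite !inE => /or4P[]/eqP-> _; rewrite ?eqxx ?orbT.
by case: (no_two_odd_parts pP qQ mW iP iQ).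
Qed.

End Rerouting.

(** * Connectivity against the size of [S] *)

Hypothesis S_gt1 : 1 < #|S|.
(** k-connectivity with [k = #|S|]: [v] is the vertex that [X] would otherwise cut off from [D]. *)
Hypothesis exit : forall (D X : {set T}) x, #|X| < #|S| -> [disjoint D & X] ->
  x \in D -> v \notin D -> v \notin X ->
  exists a b, [/\ a \in D, b \notin D, b \notin X & e a b].

(** This is the set A_P of the overview. *)
Definition touching P := [set s in S | adj (f s) P].

Lemma touchingP P s : reflect (s \in S /\ adj (f s) P) (s \in touching P).
Proof. by rewrite inE; apply: andP. Qed.

Lemma separation_notin_v P Q : separation P Q -> v \notin P.
Proof. by move=> PQ; apply/negP=> /(color_P PQ); rewrite (color_v PQ). Qed.

(** An edge leaving [P] and avoiding [X] ends either in some [s] of [S], and then [swap_S] shows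
    that [f s] touches [P], or directly in some [f s]. *)
Lemma touching_exit P Q x X : separation P Q -> x \in P -> #|X| < #|S| ->
  [disjoint P & X] -> v \notin X ->
  exists2 s, s \in touching P & s \notin X /\ adj s P \/ f s \notin X.
Proof.
move=> PQ xP ltX dPX vX.
have [a [b [aP bP bX eab]]] := exit ltX dPX xP (separation_notin_v PQ) vX.
have [bS | [s sS bE] | bP'] := P_neighbour PQ aP eab.
- have adjb : adj b P by apply/adjP; exists a; rewrite 1?e_sym.
  by exists b; [apply/touchingP; case/andP: (swap_S PQ bS adjb) | left].
- exists s; last by right; rewrite -bE.
  by apply/touchingP; split=> //; apply/adjP; exists a; rewrite -?bE 1?e_sym.
by rewrite bP' in bP.
Qed.

(** Connectivity gives an index on each side. Should both be the same [i], removing the single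
    vertex [f i], possible as [1 < #|S|], leaves an edge out of [P] that yields another index. *)
Lemma touching_distinct P Q x y : separation P Q -> x \in P -> y \in Q ->
  exists i j, [/\ i \in touching P, j \in touching Q & i != j].
Proof.
move=> PQ xP yQ; have QP := separation_sym PQ.
have S_gt0 : #|@set0 T| < #|S| by rewrite cards0 ltnW.
have d0 (X : {set T}) : [disjoint X & set0] by rewrite disjoint_sym -setI_eq0 set0I.
have v0 : v \notin set0 by rewrite inE.
have [i iP _] := touching_exit PQ xP S_gt0 (d0 P) v0.
have [j jQ _] := touching_exit QP yQ S_gt0 (d0 Q) v0.
have [ij | ij] := eqVneq i j; last by exists i, j.
move: jQ; rewrite -{j}ij => iQ.
have [[iS _] [_ fiQ]] := (touchingP _ _ iP, touchingP _ _ iQ).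
have fiP : f i \notin P by apply/negP=> /(color_P PQ); rewrite color_fS.
have fi_v : v \notin [set f i].
  by rewrite inE; apply: contraNneq vC => ->; apply: fC.
have fi_P : [disjoint P & [set f i]] by rewrite disjoint_sym disjoints1.
have [s sP [[_ adjs] | fs]] := touching_exit PQ xP
  (leq_ltn_trans (eq_leq (cards1 (f i))) S_gt1) fi_P fi_v.
  have [sS _] := touchingP _ _ sP.
  exists s, i; split=> //; apply/eqP=> si.
  by have /andP[_] := swap_S PQ sS adjs; rewrite si fiQ.
exists s, i; split=> //; apply: contraNneq fs => ->.
by rewrite inE.
Qed.

(** One of the distinct [i] and [j] differs from [s]. Used with it, [swap_fS] makes [s] adjacent to
    [P] or [Q], and [swap_S] then denies that [f s] touches the other side. *)
Lemma touching_disjoint P Q x y s : separation P Q -> x \in P -> y \in Q ->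
  s \in touching P -> s \notin touching Q.
Proof.
move=> PQ xP yQ sP; apply/negP=> sQ; have QP := separation_sym PQ.
have [i [j [iP jQ ij]]] := touching_distinct PQ xP yQ.
have [[iS fiP] [jS fjQ]] := (touchingP _ _ iP, touchingP _ _ jQ).
have [[sS fsP] [_ fsQ]] := (touchingP _ _ sP, touchingP _ _ sQ).
have [si | si] := eqVneq s i.
  have sj : j != s by rewrite si eq_sym.
  have /andP[_] := swap_S PQ sS (swap_fS QP jS sS sj fjQ fsP).
  by rewrite fsQ.
have is_ : i != s by rewrite eq_sym.
have /andP[_] := swap_S QP sS (swap_fS PQ iS sS is_ fiP fsQ).
by rewrite fsP.
Qed.

(** Some [j] in [touching Q] differs from [s] by disjointness, so [swap_fS] applies with the sides
    exchanged. *)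
Lemma touching_adj P Q x y s : separation P Q -> x \in P -> y \in Q ->
  s \in touching P -> adj s P.
Proof.
move=> PQ xP yQ sP; have QP := separation_sym PQ.
have [i [j [iP jQ ij]]] := touching_distinct PQ xP yQ.
have [[sS fsP] [jS fjQ]] := (touchingP _ _ sP, touchingP _ _ jQ).
apply: (swap_fS QP jS sS _ fjQ fsP).
by apply: contraTneq jQ => ->; apply: (touching_disjoint PQ xP yQ).
Qed.

(** The images [f r], together with [touching P], turn out to contain every neighbour that
    [P :|: f @: touching P] has outside itself. *)
Definition exits P Q := [set r in S | [&& r \notin touching P,
  r \notin touching Q & [exists i in touching P, e (f i) (f r)]]].

Lemma exitsP P Q r :
  reflect [/\ r \in S, r \notin touching P, r \notin touching Q
             & exists2 i, i \in touching P & e (f i) (f r)]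
          (r \in exits P Q).
Proof.
rewrite [r \in exits P Q]in_set; apply: (iffP idP).
  by case/and4P=> ? ? ? /exists_inP[i ? ?]; split=> //; exists i.
by case=> ? ? ? [i ? ?]; apply/and4P; split=> //; apply/exists_inP; exists i.
Qed.

(** If the bound failed, connectivity would give an edge from [a] in [D] to [b] outside [D] and [X].
    The possible places of [b], namely [S], [Q] and [f @: S], are excluded in turn. *)
Lemma card_exits P Q x y : separation P Q -> x \in P -> y \in Q ->
  #|S| <= #|touching P| + #|exits P Q|.
Proof.
move=> PQ xP yQ; have QP := separation_sym PQ.
have fE : #|f @: exits P Q| = #|exits P Q|.
  apply: card_in_imset => r t; rewrite !inE => /andP[rS _] /andP[tS _].
  exact: f_inj.
rewrite -{}fE; apply: leq_trans (leq_card_setU _ _); rewrite leqNgt.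
apply/negP=> lt.
set X := _ :|: _ in lt; pose D := P :|: f @: touching P.
have DC : D \subset C.
  rewrite subUset; apply/andP; split; apply/subsetP=> z.
    move=> zP; case: PQ => /setP/(_ z); rewrite !inE zP.
    by case/esym/andP.
  by case/imsetP=> s /touchingP[sS _] ->; apply: fC.
have vD : v \notin D by apply: contra vC; apply/subsetP.
have fXP r : r \in exits P Q -> r \in S /\ r \notin touching P.
  by rewrite inE => /and3P[].
have vX : v \notin X.
  rewrite inE negb_or; apply/andP; split.
    by apply/negP=> /touchingP[]; rewrite (negbTE vS).
  apply/imsetP=> -[r /fXP[rS _] vE]; move: vC; rewrite {1}vE.
  by rewrite fC.
have dDX : [disjoint D & X].
  rewrite disjoint_subset; apply/subsetP=> z zD; rewrite !inE negb_or.
  apply/andP; split.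
    by rewrite (disjointFl dSC) // (subsetP DC).
  apply/imsetP=> -[r /fXP[rS rP] zE]; move: zD; rewrite zE inE => /orP[].
    by move/(color_P PQ); rewrite color_fS.
  by case/imsetP=> s sP /f_inj rs; case/negP: rP; rewrite rs //; case/touchingP: sP.
have xD : x \in D by rewrite inE xP.
have [a [b [aD bD bX eab]]] := exit lt dDX xD vD vX.
have PE z s : z \in P -> s \in S -> e z (f s) -> s \in touching P.
  by move=> zP sS ezs; apply/touchingP; split=> //; apply/adjP; exists z; rewrite 1?e_sym.
(* For [a] in [P] this is [swap_S]; for [a = f s] it is [cross_fS_S]. *)
have bSX : b \in S -> b \in touching P.
  move=> bS; case/setUP: aD => [aP | /imsetP[s sP aE]].
    have adjb : adj b P by apply/adjP; exists a; rewrite 1?e_sym.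
    by apply/touchingP; split=> //; case/andP: (swap_S PQ bS adjb).
  apply: contraT => nb; have [sS fsP] := touchingP _ _ sP.
  have := cross_fS_S PQ sS bS (touching_adj PQ xP yQ sP); rewrite -aE eab; apply.
  by apply: contra nb => fbP; apply/touchingP.
have bS : b \notin S by apply: contra bX => /bSX bP; rewrite inE bP.
have aC := subsetP DC _ aD.
have bC := C_closed aC bS eab.
have [/imsetP[r rS bE] | nbf] := boolP (b \in f @: S); last first.
  have: b \in P :|: Q by case: PQ => -> _ _; rewrite inE nbf.
  case/setUP=> [bP | bQ]; first by rewrite inE bP in bD.
  case/setUP: aD => [aP | /imsetP[s sP aE]].
    by case: PQ => _ _ /(_ _ _ aP bQ); rewrite eab.
  (* An edge from [f s] into [Q] would put [s] into both touching sets. *)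
  have [sS _] := touchingP _ _ sP.
  have : s \in touching Q by apply/touchingP; split=> //; apply/adjP; exists b; rewrite // -aE.
  by rewrite (negbTE (touching_disjoint PQ xP yQ sP)).
have rP : r \notin touching P.
  by apply: contra bD => rP; rewrite inE bE imset_f ?orbT.
case/setUP: aD => [aP | /imsetP[s sP aE]].
  by case/negP: rP; apply: PE aP rS _; rewrite -bE.
have [sS _] := touchingP _ _ sP.
have rQ : r \notin touching Q.
  apply/negP=> rQ; have := cross_fS_fS PQ sS rS.
  rewrite -aE -bE eab => /(_ _ (touching_adj PQ xP yQ sP)
    (touching_adj QP yQ xP rQ)) H.
  by have /H : s != r by apply: contraNneq rP => <-.
case/negP: bX; rewrite inE bE imset_f ?orbT //; apply/exitsP; split=> //.
by exists s; rewrite // -aE -bE.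
Qed.

(** The two touching sets and the exits are pairwise disjoint within [S], whereas by [card_exits]
    one touching set and its exits already account for [#|S|] elements. The other touching set is
    nonempty, so the counts clash. *)
Lemma no_separation P Q x y : separation P Q -> x \in P -> y \in Q -> False.
Proof.
move=> PQ xP yQ; have QP := separation_sym PQ.
have leP := card_exits PQ xP yQ; have leQ := card_exits QP yQ xP.
have same r t : r \in exits P Q -> t \in exits Q P -> r = t.
  case/exitsP=> rS rP rQ [i iP eir] /exitsP[tS tQ tP [j jQ ejt]].
  have nP s : s \in S -> s \notin touching P -> ~~ adj s P.
    by move=> sS; apply: contra => /(swap_S PQ sS)/andP[? _]; apply/touchingP.
  have nQ s : s \in S -> s \notin touching Q -> ~~ adj s Q.
    by move=> sS; apply: contra => /(swap_S QP sS)/andP[? _]; apply/touchingP.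
  have ij : i != j.
    by apply: contraTneq jQ => <-; apply: (touching_disjoint PQ xP yQ).
  have [[iS _] [jS _]] := (touchingP _ _ iP, touchingP _ _ jQ).
  exact: (common_exit PQ iS jS rS tS ij (touching_adj PQ xP yQ iP)
    (touching_adj QP yQ xP jQ) (nP r rS rP) (nQ r rS rQ) (nP t tS tP)
    (nQ t tS tQ) eir ejt).
have dPQ : #|touching P| + #|touching Q| + #|exits P Q| <= #|S|.
  have d1 : [disjoint touching P & touching Q].
    rewrite disjoint_subset; apply/subsetP=> s; exact: (touching_disjoint PQ xP yQ).
  have d2 : [disjoint touching P :|: touching Q & exits P Q].
    rewrite disjoint_subset; apply/subsetP=> s; rewrite !inE => /orP[]/andP[-> ->] //=.
    by rewrite andbF.
  have := leq_card_setU (touching P) (touching Q); rewrite d1 => /leqifP/eqP<-.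
  have := leq_card_setU (touching P :|: touching Q) (exits P Q).
  rewrite d2 => /leqifP/eqP<-; apply: subset_leq_card.
  by apply/subsetP=> s; rewrite !inE => /orP[/orP[]|]/andP[].
have card1 (A B : {set T}) :
    (forall r t, r \in A -> t \in B -> r = t) -> 0 < #|B| -> #|A| <= 1.
  move=> AB /card_gt0P[t tB]; rewrite -(cards1 t); apply: subset_leq_card.
  by apply/subsetP=> r rA; rewrite inE; apply/eqP/AB.
have [i [j [iP jQ _]]] := touching_distinct PQ xP yQ.
have P0 : 0 < #|touching P| by apply/card_gt0P; exists i.
have Q0 : 0 < #|touching Q| by apply/card_gt0P; exists j.
have eP : 0 < #|exits P Q| by lia.
have eQ : #|exits Q P| <= 1 by apply: card1 eP => r t rQ tP; rewrite (same t r).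
lia.
Qed.

End Swapping.

(** * Components and k-connectivity *)

Section Connectivity.
Variables (T : finType) (e : rel T).
Hypothesis e_sym : symmetric e.
Implicit Types U D X : {set T}.

Lemma connect_induced_sym U : connect_sym (induced e U).
Proof.
by apply: sym_connect_sym => x y; rewrite /induced /= e_sym andbCA.
Qed.

Lemma connect_induced_eqr U :
  {in U & &, equivalence_rel (connect (induced e U))}.
Proof.
move=> x y z _ _ _; split=> [|xy]; first exact: connect0.
exact: same_connect (connect_induced_sym U) _ _ xy z.
Qed.

Lemma components_partition U : partition (components e U) U.
Proof. exact/equivalence_partitionP/connect_induced_eqr. Qed.

Lemma component_sub U D : D \in components e U -> D \subset U.
Proof.
by case/and3P: (components_partition U) => /eqP cU _ _ DU; rewrite -cU bigcup_sup.
Qed.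

Lemma component_closed U D x y :
  D \in components e U -> x \in D -> y \in U -> e x y -> y \in D.
Proof.
move=> DU xD yU exy; case/and3P: (components_partition U) => _ tI _.
have xU := subsetP (component_sub DU) x xD.
rewrite -(def_pblock tI DU xD).
rewrite (pblock_equivalence_partition (@connect_induced_eqr U)) //.
by apply: connect1; rewrite /induced /= xU yU.
Qed.

Lemma components_disjoint U D1 D2 : D1 \in components e U ->
  D2 \in components e U -> D1 != D2 -> [disjoint D1 & D2].
Proof.
by case/and3P: (components_partition U) => _ /trivIsetP tI _; apply: tI.
Qed.

Lemma component_nonempty U D : D \in components e U -> exists x, x \in D.
Proof.
case/and3P: (components_partition U) => _ _ n0 DU; apply/set0Pn.
by apply: contraNneq n0 => <-.
Qed.

Lemma k_connected_exit k D X x y : k_connected e k -> #|X| < k ->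
  [disjoint D & X] -> x \in D -> y \notin D -> y \notin X ->
  exists a b, [/\ a \in D, b \notin D, b \notin X & e a b].
Proof.
move=> [_ kconn] ltX dDX xD yD yX.
have [/exists_inP[a aD /existsP[b /and3P[bD bX eab]]] | none] :=
  boolP [exists a in D, exists b, [&& b \notin D, b \notin X & e a b]].
  by exists a, b.
have clD : closed (induced e (~: X)) D.
  apply: (intro_closed (connect_induced_sym _)) => a b /and3P[_ bX eab] aD.
  apply: contraR none => bD; apply/exists_inP; exists a => //.
  by apply/existsP; exists b; rewrite bD -in_setC bX.
have xX : x \in ~: X by rewrite inE (disjointFr dDX).
have yX' : y \in ~: X by rewrite inE.
by have := closed_connect clD (kconn X ltX x y xX yX'); rewrite xD (negbTE yD).
Qed.

Lemma disconnected_split U x y : x \in U -> y \in U ->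
  ~~ connect (induced e U) x y ->
  exists P : {set T}, [/\ P \subset U, x \in P, y \in U :\: P
    & forall a b, a \in P -> b \in U :\: P -> ~~ e a b].
Proof.
move=> xU yU nxy; exists [set z in U | connect (induced e U) x z].
split; first by apply/subsetP=> z; rewrite inE => /andP[].
- by rewrite inE xU connect0.
- by rewrite !inE yU nxy.
move=> a b; rewrite !inE => /andP[aU xa] /andP[+ bU]; rewrite bU.
by apply: contra => eab; apply: connect_trans xa (connect1 _); rewrite /induced /= aU bU.
Qed.

End Connectivity.

(** * The matching, the component count and the structure of the remainder *)

Theorem theorem6 (k : nat) (hk : 2 <= k)
    (T : finType) (e : rel T) (e_sym : symmetric e) (e_irr : irreflexive e)
    (hconn : k_connected e k)
    (hequi : equimatchable e [set: T])
    (hfc : factor_critical e [set: T])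
    (S : {set T}) (hcut : vertex_cut e S) (hS : #|S| = k)
    (hsingle : exists v : T, [set v] \in components e (~: S))
    (C : {set T}) (hC : C \in components e (~: S)) (hCk : k <= #|C|) :
  #|components e (~: S)| = 2 /\
  exists M : {set {set T}},
    [/\ matching e [set: T] M,
        forall E, E \in M -> exists x y, [/\ x \in S, y \in C & E = [set x; y]],
        S \subset cover M,
        connected e (C :\: cover M)
      & randomly_matchable e (C :\: cover M)].
Proof.
case: hsingle => v hv.
have vC_ne : [set v] != C by apply: contraTneq hCk => <-; rewrite cards1 -ltnNge.
have vS : v \notin S by have := component_sub e_sym hv; rewrite sub1set inE.
have vC : v \notin C by have := components_disjoint e_sym hv hC vC_ne; rewrite disjoints1.
have dSC : [disjoint S & C].
  by rewrite disjoint_sym disjoints_subset (component_sub e_sym hC).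
have exit (D X : {set T}) x y : #|X| < #|S| -> [disjoint D & X] -> x \in D ->
    y \notin D -> y \notin X ->
    exists a b, [/\ a \in D, b \notin D, b \notin X & e a b].
  by rewrite hS; apply: k_connected_exit.
(* Deleting [S :\ s], which has k - 1 vertices, cannot cut [D] off from [y], so [s] has a neighbour
   in [D]. *)
have S_adj D x y s : D \in components e (~: S) -> x \in D -> y \notin D ->
    y \notin S -> s \in S -> exists2 d, d \in D & e s d.
  move=> hD xD yD yS sS.
  have lt : #|S :\ s| < #|S| by rewrite (cardsD1 s S) sS.
  have dD : [disjoint D & S :\ s].
    apply: disjointWr (subsetDl _ _) _.
    by rewrite disjoints_subset (component_sub e_sym hD).
  have [|a [b [aD bD bS eab]]] := exit _ _ x y lt dD xD yD.
    by rewrite inE negb_and yS orbT.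
  have [bs | bs] := eqVneq b s; first by exists a; rewrite // e_sym -bs.
  case/negP: bD; apply: (component_closed e_sym hD aD _ eab).
  by move: bS; rewrite !inE bs.
have [c cC] : exists c, c \in C by apply/card_gt0P; apply: leq_trans hCk; apply: ltnW.
have cS : c \notin S by rewrite (disjointFl dSC cC).
have cv : c \notin [set v] by rewrite inE; apply: contraNneq vC => <-.
have evS x : e v x = (x \in S).
  apply/idP/idP=> [evx | xS].
    apply: contraT => xS; have : x \in [set v].
      by apply: (component_closed e_sym hv _ _ evx); rewrite ?inE.
    by rewrite inE => /eqP xv; rewrite xv e_irr in evx.
  by have [d /set1P->] := S_adj _ v c x hv (set11 v) cv cS xS; rewrite e_sym.
have C_closed x y : x \in C -> y \notin S -> e x y -> y \in C.
  by move=> xC yS; apply: (component_closed e_sym hC); rewrite ?inE.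
have [f f_inj fN] : exists2 f : T -> T, {in S &, injective f}
    & {in S, forall s, f s \in [set y in C | e s y]}.
  (* If [X] violated Hall's condition, [Z] would be a cut of fewer than k vertices between [v] and
     [C :\: NX], which is nonempty because [C] has at least k vertices. *)
  apply: hall => X XS; rewrite leqNgt; apply/negP=> lt.
  set NX := \bigcup_(x in X) _ in lt.
  pose Z := (S :\: X) :|: NX.
  have ltZ : #|Z| < #|S|.
    apply: leq_ltn_trans (leq_card_setU _ _) _.
    by rewrite -(cardsID X S) (setIidPr XS) addnC ltn_add2r.
  have NXC : NX \subset C by apply/bigcupsP=> x _; apply/subsetP=> y; rewrite inE => /andP[].
  have [d dD] : exists d, d \in C :\: NX.
    apply/card_gt0P; rewrite cardsD (setIidPr NXC) subn_gt0.
    by apply: leq_trans lt _; apply: leq_trans hCk; rewrite -hS subset_leq_card.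
  have dDZ : [disjoint C :\: NX & Z].
    rewrite disjoint_subset; apply/subsetP=> z; rewrite !inE => /andP[zN zC].
    by rewrite (negbTE zN) (disjointFl dSC zC) andbF.
  have [||a [b []]] := exit _ _ d v ltZ dDZ dD.
  - by rewrite inE (negbTE vC) andbF.
  - by rewrite !inE (negbTE vS) andbF /=; apply: contra vC; apply: (subsetP NXC).
  case/setDP=> aC aN; rewrite !inE !negb_or !negb_and !negbK => bD /andP[bZ bN] eab.
  have [bS | bS] := boolP (b \in S); last first.
    by move: bD; rewrite (negbTE bN) (C_closed _ _ aC bS eab).
  case/negP: aN; apply/bigcupP; exists b; first by rewrite bS orbF in bZ.
  by rewrite inE aC e_sym.
have fC : {in S, forall s, f s \in C} by move=> s /fN; rewrite inE => /andP[].
have ef : {in S, forall s, e s (f s)} by move=> s /fN; rewrite inE => /andP[].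
have S_gt1 : 1 < #|S| by rewrite hS.
pose M := [set [set s; f s] | s in S].
have pM : perfect_matching e (S :|: f @: S) M.
  apply: perfect_matching_fun => //; apply: disjointWr dSC.
  by apply/subsetP=> _ /imsetP[s sS ->]; apply: fC.
have [mM /eqP cM] := andP pM.
have CM : C :\: cover M = C :\: f @: S.
  by move: dSC; rewrite disjoint_sym cM -setDDl => /setDidPl->.
have mM' := matchingS (subsetT _) mM.
split.
  suff -> : components e (~: S) = [set [set v]; C] by rewrite cards2 vC_ne.
  apply/eqP; rewrite eqEsubset; apply/andP; split; last first.
    by apply/subsetP=> D /set2P[] ->.
  apply/subsetP=> D hD; apply/set2P.
  have [-> | Dv] := eqVneq D [set v]; first by left.
  have [-> | DC] := eqVneq D C; first by right.
  exfalso.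
  have [d dD] := component_nonempty e_sym hD.
  have vD : v \notin D.
    by have := components_disjoint e_sym hD hv Dv; rewrite disjoint_sym disjoints1.
  have dDC := components_disjoint e_sym hD hC DC.
  have DS x : x \in D -> x \notin S.
    by move/(subsetP (component_sub e_sym hD)); rewrite inE.
  have DfS x : x \in D -> x \notin f @: S.
    by move=> xD; apply/imsetP=> -[s /fC sC xE]; rewrite -xE (disjointFr dDC) in sC.
  have D_closed x y : x \in D -> y \notin S -> e x y -> y \in D.
    by move=> xD yS; apply: (component_closed e_sym hD xD); rewrite inE.
  have vfS : v \notin f @: S.
    by apply/imsetP=> -[s /fC sC vE]; rewrite -vE (negbTE vC) in sC.
  have [s sS] : exists s, s \in S by apply/card_gt0P; apply: ltnW.
  have [d' d'D esd] := S_adj _ d v s hD dD vD vS sS.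
  have even W X := @isolating_even T e e_sym e_irr hequi hfc S v evS W X.
  have evenD : ~~ odd #|D|.
    apply: (even (S :|: f @: S)); rewrite ?subsetUl //; first by exists M.
      by rewrite inE negb_or vS.
    split=> [|x y xD]; last by rewrite inE => /norP[yS _]; apply: D_closed.
    by rewrite disjoint_subset; apply/subsetP=> x xD; rewrite !inE negb_or DS ?DfS.
  (* Replace [{s, f s}] by [{s, d'}]: the freed [f s] lies in another component, so [D :\ d'] is
     isolated and even, like [D] itself. *)
  have oddD : ~~ odd #|D :\ d'|.
    pose m := matched S f [set s].
    have memS := mem_matched_S dSC fC [set s].
    have xm x : x \notin S -> x \notin f @: S -> x \notin m by apply: notin_matched.
    apply: (even (s |: (d' |: m))).
    - apply: matchableU2 => //; first by rewrite memS ?inE ?eqxx.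
        by apply: xm; rewrite ?DS ?DfS.
      exact: matchable_matched dSC f_inj fC ef _.
    - apply/subsetP=> x xS; rewrite !inE memS // inE.
      by case: eqP => //=; rewrite orbT.
    - rewrite !inE !negb_or xm // andbT.
      by apply/andP; split; [apply: contraNneq vS => -> | apply: contraNneq vD => ->].
    - by rewrite inE (negbTE vD) andbF.
    split=> [|x y /setD1P[_ xD]].
      rewrite disjoint_subset; apply/subsetP=> x /setD1P[xd xD].
      rewrite !inE !negb_or xd xm ?DS ?DfS // !andbT.
      by apply: contraTneq xD => ->; apply: contraL sS; apply: DS.
    rewrite !inE !negb_or => /and3P[ys yd ym] exy; rewrite yd; apply: D_closed exy => //.
    by apply: contra ym => yS; rewrite memS ?inE.
  by move: evenD; rewrite (cardsD1 d') d'D /= (negbTE oddD).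
exists M; rewrite CM; split=> //.
- by move=> _ /imsetP[s sS ->]; exists s, (f s); split; rewrite ?fC.
- by rewrite cM subsetUl.
- move=> x y xH yH; apply: contraT => /(disconnected_split xH yH)[P [PH xP yQ ePQ]].
  have PQ : separation e S C f P ((C :\: f @: S) :\: P).
    split=> //; first by rewrite -{1}(setIidPr PH) setID.
    by rewrite disjoint_sym disjoints_subset subsetDr.
  exfalso.
  apply: (no_separation e_sym e_irr hequi hfc vS vC dSC evS C_closed f_inj fC ef
    S_gt1 _ PQ xP yQ).
  by move=> D X z ltX dDX zD vD vX; apply: exit ltX dDX zD vD vX.
(* A vertex [x] missed by [N] would be isolated once [M] and [N] are in place, giving the odd sets
   [[set x]] and [[set v]]. *)
have perfect N : maximal_matching e (C :\: f @: S) N -> cover N = C :\: f @: S.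
  move=> maxN; have mN := maxsetp maxN; apply/eqP; rewrite eqEsubset.
  rewrite (matching_cover_sub mN); apply: contraT => /subsetPn[x xH xN].
  exfalso.
  have dMN : [disjoint S :|: f @: S & cover N].
    apply: disjointWr (matching_cover_sub mN) _.
    rewrite disjoint_subset; apply/subsetP=> z; rewrite !inE.
    by case/orP=> [zS | ->] //; rewrite (disjointFr dSC zS) andbF.
  have pN : perfect_matching e (cover N) N.
    apply/andP; split=> //; case/andP: mN => /subsetP sN tN.
    apply/andP; split=> //; apply/subsetP=> E EN.
    case/edgesP: (sN _ EN) => a [b [_ _ eab EE]].
    apply/edgesP; exists a, b; split=> //; apply/bigcupP;
      by exists E; rewrite // EE !inE eqxx ?orbT.
  pose W := (S :|: f @: S) :|: cover N.
  have mW : matchable e W by exists (M :|: N); apply: perfect_matchingU.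
  have SW : S \subset W by rewrite /W -setUA subsetUl.
  have vW : v \notin W.
    rewrite !inE !negb_or vS /=; apply/andP; split.
      by apply/imsetP=> -[s /fC sC vE]; rewrite -vE (negbTE vC) in sC.
    by apply: contra vC => /(subsetP (matching_cover_sub mN)) /setDP[].
  have [xC xf] := setDP xH.
  (* A neighbour [y] of [x] outside [W] would lie in the remainder, and [{x, y}] could be added to
     [N]. *)
  have iX : isolated e W [set x].
    split=> [|_ y /set1P-> yW exy].
      by rewrite disjoints1 !inE (disjointFl dSC xC) (negbTE xf).
    move: yW; rewrite !inE !negb_or => /andP[/andP[yS yf] yN].
    have yC := C_closed _ _ xC yS exy.
    exfalso.
    have p2 := perfect_matching2 exy.
    have mE : matching e (C :\: f @: S) (N :|: [set [set x; y]]).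
      apply: matchingU => //.
        case/andP: p2 => m2 _; apply: matchingS m2.
        by apply/subsetP=> z /set2P[] ->; rewrite inE ?yf ?xf.
      rewrite cover1 disjoint_sym disjoints_subset; apply/subsetP=> z.
      by rewrite in_setC => /set2P[] ->.
    have := maxsetsup maxN mE (subsetUl _ _) => NE.
    by case/negP: xN; rewrite -NE coverU cover1 !inE eqxx orbT.
  have := isolating_even e_sym e_irr hequi hfc evS mW SW vW _ iX.
  have vx : v != x by apply: contraNneq vC => ->.
  by rewrite cards1 inE => /(_ vx).
(* Every maximal matching covers the whole remainder, so none is smaller than another matching, and
   extending the empty matching yields a perfect one. *)
split.
  move=> N maxN; have mN := maxsetp maxN; split=> // N' mN'.
  rewrite -leq_double -(card_cover_matching e_irr mN) -(card_cover_matching e_irr mN').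
  by rewrite (perfect N maxN) subset_leq_card ?(matching_cover_sub mN').
have [N maxN _] := maxset_exists (matching0 e (C :\: f @: S)).
by exists N; rewrite /perfect_matching (maxsetp maxN) perfect ?eqxx.
Qed.
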